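(* Let $\pi$ be a set of primes and let $G$ be a finite group containing a Hall $\pi$-subgroup $H$ which is also a T.I. subgroup of $G$. Then any $\pi$-subgroup of $G$ is contained in a conjugate of $H$. In particular, the set of all Hall $\pi$-subgroups of $G$ forms a single $G$-conjugacy class.
   Context: A subgroup $H$ of a group $G$ is a T.I. subgroup if for every $x\in G$ the intersection $H\cap H^x$ is either $H$ or trivial. A $\pi$-subgroup is a subgroup whose order is divisible only by primes in $\pi$; a Hall $\pi$-subgroup is a $\pi$-subgroup whose index is divisible by no prime in $\pi$. *)

(* Defs.v *)
From mathcomp Require Import all_boot all_fingroup all_solvable.

Set Implicit Arguments.
Unset Strict Implicit.
Unset Printing Implicit Defensive.

Import GroupScope.

Definition TI_subgroup (gT : finGroupType) (G H : {group gT}) : Prop :=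
  H \subset G /\
  forall x, x \in G -> H :&: H :^ x = H \/ H :&: H :^ x = 1.

(* Main.v *)
Require Import Defs.
From mathcomp Require Import all_boot all_fingroup all_solvable.

Set Implicit Arguments.
Unset Strict Implicit.
Unset Printing Implicit Defensive.

Import GroupScope.

(** The proof is a count inside a [pi]-subgroup [K != 1].  Distinct conjugates
of [H] meet trivially ([TI_conj_eq]), and a [pi]-subgroup normalising a
conjugate [C] of [H] lies in [C] ([pgroup_norm_Hall]).  So if [L := K :&: C] is
nontrivial, then [L] is a self-normalising T.I. subgroup of [K]
([TI_Hall_meet_normedTI]), and the [K]-conjugates of [L^#] cover
[#|K| - #|K : L|] elements of [K^#], that is at least half of [#|K|].  As [K^#]
has fewer than [#|K|] elements, there is only room for one [K]-orbit of
conjugates of [H] that meet [K] nontrivially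
([TI_Hall_meet_card]).

By Sylow's theorem in [G], each Sylow subgroup of [K] lies in some conjugate of
[H].  All the conjugates needed for this being in one [K]-orbit, their
intersections with [K] have the same order, which is therefore divisible by the
full [p]-part of [#|K|] for every prime [p]; hence [K] is equal to such an
intersection.  A proper such [L] would be a Frobenius complement in [K], but
the count makes Frobenius' theorem unnecessary. *)

(** [C] is a normal Hall [pi]-subgroup of ['N_G(C)], so it contains all the
[pi]-subgroups of ['N_G(C)]. *)
Lemma pgroup_norm_Hall (gT : finGroupType) (pi : nat_pred)
    (G C N : {group gT}) :
  pi.-Hall(G) C -> pi.-group N -> N \subset G -> N \subset 'N(C) ->
  N \subset C.
Proof.
move=> hallC piN sNG nCN; have sCG := pHall_sub hallC.
rewrite (@sub_normal_Hall _ pi 'N_G(C)) ?normal_subnorm ?subsetI ?sNG //.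
  by apply: pHall_subl hallC; rewrite ?subsetIl // subsetI sCG normG.
Qed.

(** The support has [(#|L| - 1) * #|K : L|] elements, and [#|L| - 1] is at least
[#|L| / 2] because [L] is nontrivial. *)
Lemma half_le_TI_support (gT : finGroupType) (K L : {group gT}) :
  normedTI L^# K L -> #|K| <= (#|class_support L^# K|).*2.
Proof.
move=> tiL; have [ntL sLK _] := normedTI_memJ_P tiL.
rewrite (card_support_normedTI tiL) -(Lagrange sLK) doubleMl leq_mul2r.
apply/orP; right; move: ntL; rewrite -card_gt0 (cardsD1 1 L) group1.
by rewrite -addnn leq_add2r.
Qed.

Section TIHall.

Variables (gT : finGroupType) (pi : nat_pred) (G H : {group gT}).
Hypotheses (hallH : pi.-Hall(G) H) (tiH : TI_subgroup G H).

Lemma TI_conj_eq x y a : x \in G -> y \in G ->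
  a \in H :^ x -> a \in H :^ y -> a != 1 -> H :^ x = H :^ y.
Proof.
move=> Gx Gy Hxa Hya nta.
have [_ /(_ (y * x^-1))] := tiH.
rewrite groupM ?groupV // => /(_ isT) [eqI | tI].
  apply/eqP; rewrite eqEcard !cardJg leqnn andbT.
  by rewrite sub_conjg -conjsgM -{1}eqI subsetIr.
have: a ^ x^-1 \in H :&: H :^ (y * x^-1).
  by rewrite inE -mem_conjg Hxa conjsgM memJ_conjg Hya.
by rewrite tI inE conjg_eq1 (negPf nta).
Qed.

Variable K : {group gT}.
Hypotheses (sKG : K \subset G) (piK : pi.-group K).

(** An element [g] of [K] moving some [a != 1] of [K :&: H :^ x] within
[H :^ x] fixes [H :^ x], so that [<[g]>] is a [pi]-group normalising a Hall
[pi]-subgroup. *)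
Lemma TI_Hall_meet_normedTI x : x \in G -> K :&: H :^ x != 1 ->
  normedTI (K :&: H :^ x)^# K (K :&: H :^ x).
Proof.
move=> Gx ntL; apply/normedTI_memJ_P.
split=> [||a g]; rewrite ?subsetIl ?setD_eq0 ?subG1 //.
case/setD1P=> nta /setIP[Ka Ha] Kg; have Gg := subsetP sKG g Kg.
apply/idP/idP=> [|Lg]; last first.
  by rewrite !inE conjg_eq1 nta -in_setI groupJ // inE Ka.
case/setD1P=> ntag /setIP[_ Hag]; rewrite inE Kg -cycle_subG.
apply: (@pgroup_norm_Hall _ pi G (H :^ x)%G).
- by rewrite pHallJ.
- by rewrite (pgroupS _ piK) ?cycle_subG.
- by rewrite cycle_subG.
rewrite cycle_subG; apply/normP; rewrite /= -conjsgM.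
by apply: TI_conj_eq (groupM Gx Gg) Gx _ Hag ntag; rewrite conjsgM memJ_conjg.
Qed.

(** If [H :^ x] and [H :^ y] were in different [K]-orbits, the conjugates of
their intersections with [K] would yield two disjoint subsets of [K^#] of
cardinality at least [#|K| / 2]. *)
Lemma TI_Hall_meet_card x y : x \in G -> y \in G ->
    K :&: H :^ x != 1 -> K :&: H :^ y != 1 ->
  #|K :&: H :^ x| = #|K :&: H :^ y|.
Proof.
move=> Gx Gy ntL ntM.
have /half_le_TI_support leL := TI_Hall_meet_normedTI Gx ntL.
have /half_le_TI_support leM := TI_Hall_meet_normedTI Gy ntM.
set A := class_support _ _ in leL; set B := class_support _ _ in leM.
have [dAB | ] := boolP [disjoint A & B].
  have sK1 z : class_support (K :&: H :^ z)^# K \subset K^#.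
    apply/subsetP=> _ /imset2P[a k /setD1P[nta /setIP[Ka _]] Kk ->].
    by rewrite !inE conjg_eq1 nta groupJ.
  have: #|A :|: B| <= #|K^#| by rewrite subset_leq_card // subUset !sK1.
  have := cardsUI A B; rewrite (disjoint_setI0 dAB) cards0 addn0 => ->.
  have := cardsD1 1 K; rewrite group1 => cK le.
  have := leq_add leL leM; rewrite -doubleD addnn leq_double => leK.
  by have := leq_trans leK le; rewrite cK ltnn.
case/pred0Pn=> a /andP[/imset2P[b k /setD1P[ntb /setIP[_ Hb]] Kk ->]].
case/imset2P=> c l /setD1P[_ /setIP[_ Hc]] Kl eqbc.
have eqH : H :^ (x * k) = H :^ (y * l).
  apply: (@TI_conj_eq _ _ (b ^ k)).
  - by rewrite groupM // (subsetP sKG).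
  - by rewrite groupM // (subsetP sKG).
  - by rewrite /= conjsgM memJ_conjg.
  - by rewrite eqbc conjsgM memJ_conjg.
  by rewrite conjg_eq1.
rewrite -(cardJg _ k) -(cardJg (K :&: H :^ y) l).
by rewrite !conjIg (conjGid Kk) (conjGid Kl) -!conjsgM eqH.
Qed.

(** [#|K|] divides [#|K :&: H :^ x|] for any conjugate [H :^ x] that meets [K]
nontrivially, one prime at a time: a Sylow [p]-subgroup of [K] lies in some
[H :^ y], and [K] meets [H :^ x] and [H :^ y] in subgroups of equal order. *)
Lemma pgroup_sub_TI_Hall : exists2 x, x \in G & K \subset H :^ x.
Proof.
have [-> | ntK] := eqVneq (K : {set gT}) 1; first by exists 1; rewrite ?sub1G.
have sylK p : p \in \pi(K) ->
    exists x, [/\ x \in G, K :&: H :^ x != 1 & #|K|`_p %| #|K :&: H :^ x|].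
  move=> pK; have [P sylP] := Sylow_exists p K.
  have [sPK pP _] := and3P sylP; have oP := card_Hall sylP.
  have [x Gx sPHx] := Hall_psubJ hallH (pnatPpi piK pK)
                        (subset_trans sPK sKG) pP.
  exists x; have dv: #|P| %| #|K :&: H :^ x| by rewrite cardSg // subsetI sPK.
  split=> //; last by rewrite -oP.
  apply: contraTneq dv => ->; rewrite cards1 dvdn1 oP.
  by rewrite p_part_eq1 negbK.
(* Any prime divisor of #|K| provides a conjugate meeting K nontrivially. *)
have [x [Gx ntL _]] : exists x, [/\ x \in G, K :&: H :^ x != 1
                                  & #|K|`_(pdiv #|K|) %| #|K :&: H :^ x|].
  by apply: sylK; rewrite pi_pdiv cardG_gt1.
exists x => //; apply/setIidPl/eqP; rewrite eqEcard subsetIl /=.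
apply: dvdn_leq => //; apply/dvdn_partP=> // p /sylK[y [Gy ntM]].
by rewrite (TI_Hall_meet_card Gx Gy).
Qed.

End TIHall.

Theorem proposition1p5 (gT : finGroupType) (pi : nat_pred) (G H : {group gT})
    (pi_primes : forall p : nat, p \in pi -> prime p)
    (hallH : pi.-Hall(G) H) (tiH : TI_subgroup G H) :
  (forall K : {group gT}, K \subset G -> pi.-group K ->
     exists2 x, x \in G & K \subset H :^ x) /\
  [transitive G, on [set K : {group gT} | pi.-Hall(G) K] | 'JG].
Proof.
have subJ := pgroup_sub_TI_Hall hallH tiH.
split=> //; apply/imsetP; exists H; first by rewrite inE.
apply/setP=> K; rewrite inE; apply/idP/imsetP=> [hallK | [x Gx ->]].
  have [x Gx sKHx] := subJ K (pHall_sub hallK) (pHall_pgroup hallK).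
  exists x => //; apply/val_inj/eqP; rewrite /= eqEcard sKHx cardJg.
  by rewrite (card_Hall hallK) (card_Hall hallH) leqnn.
by rewrite /= pHallJ.
Qed.
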